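(* Let $d\ge1$, $s,s',r_1,r_2\in\mathbb{R}$ with $r_1-d/2>s$, and let $t>s$, $t'>s'$. Let $$\gamma=\min\left\{\frac12,\ \frac{t-s}{2(r_1-s)+d},\ \frac{t'-s'}{(2(-r_2-s')+d)_+}\right\}.$$ Fix a target accuracy $\varepsilon\in(0,1)$ and choose $N$ so that $\varepsilon=N^{-\gamma}$ (with $N\ge3$ an integer), and let $\delta\in(0,1)$. Then the scale-adaptive blockwise least-squares estimator defined in the context, built from $N$ samples with confidence parameter $\delta$ and implemented by columnwise dense least squares, has arithmetic cost satisfying $$ \mathsf{Cost}(\varepsilon)\ \lesssim_{\log}\ \varepsilon^{-\kappa},\qquad \kappa=\max\{\kappa_{\rm in},\kappa_{\rm out}\}, $$ where $$ \kappa_{\rm in}=2+\frac{2d}{\min\{r_1,t\}-s}+\frac{(2(r_1-t)+d)_+}{t-s}, \qquad \kappa_{\rm out}=\frac{d+(2(-r_2-s')+d)_+}{t'-s'}=\max\left\{\frac{d}{t'-s'},\ \frac{2(-r_2-s')+2d}{t'-s'}\right\}. $$ Here $\lesssim_{\log}$ means up to a multiplicative constant and polylogarithmic factors in $\varepsilon^{-1}$ and $\delta^{-1}$, with constants and powers of logarithms depending only on the fixed parameters $d,s,s',r_1,r_2,t,t'$, the wavelet basis and the constant $C_0$ in the definition of the estimator.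
   Context: Problem. On the torus $\mathbb{T}^d=(\mathbb{R}/\mathbb{Z})^d$, with $L^2$-based Sobolev spaces $H^a$, one observes $f_i=\mathcal{A}u_i+w_i$, $1\le i\le N$, where $\mathcal{A}:H^s\to H^{-s'}$ is an unknown bounded linear operator with norm at most a fixed $R>0$, $u_i$ are i.i.d. centered Gaussian fields with covariance operator $(I-\Delta)^{-r_1}$, and $w_i$ are i.i.d. centered Gaussian fields with covariance operator $(I-\Delta)^{-r_2}$, independent of the $u_i$. Conventions: $a_+=\max\{a,0\}$, $a/0=+\infty$ for $a>0$. Wavelets. Fix an orthonormal wavelet basis $\{\varphi_\lambda\}_{\lambda\in\Lambda}$ of $L^2(\mathbb{T}^d)$, $\Lambda=\{\lambda=(j,k):j\ge0,\ k\in\nabla_j\}$, $|\nabla_j|\asymp2^{jd}$, $|\lambda|:=j$, with enough regularity and vanishing moments that $\|h\|_{H^a}^2\asymp\sum_\lambda2^{2a|\lambda|}|\langle h,\varphi_\lambda\rangle|^2$ for every Sobolev index $a$ that occurs. Let $\mathbf{U},\mathbf{F}\in\mathbb{R}^{N\times\Lambda}$ be the matrices whose $i$-th rows are the wavelet coefficients of $u_i$ and $f_i$. For a set $I$ of scales, $\Lambda_I=\{(j,k)\in\Lambda:j\in I\}$, $\Lambda_j=\Lambda_{\{j\}}$; $\mathbf{U}_I$ denotes the columns of $\mathbf{U}$ indexed by $\Lambda_I$, and $\mathbf{F}_{j'}$ the columns of $\mathbf{F}$ indexed by $\Lambda_{j'}$. Cutoffs. For $j'=0,1,\dots,\lceil\frac{\gamma\log_2N}{t'-s'}\rceil$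 let $$J(j')=\Big\lceil\tfrac{\gamma\log_2N-j'(t'-s')}{t-s}\Big\rceil,\quad \widetilde J(j')=\Big\lceil\tfrac{\gamma\log_2N-j'(t'-s')}{\min\{r_1,t\}-s}\Big\rceil,\quad \widetilde I_{j'}=\{0,1,\dots,\widetilde J(j')\}$$ (empty if $\widetilde J(j')<0$), and $\mathcal{E}_N=\{(\lambda,\lambda')\in\Lambda\times\Lambda:\ |\lambda|(t-s)+|\lambda'|(t'-s')\le\gamma\log_2N\}$. Estimator. With $C_0>0$ a fixed constant, set $N_{j'}=\min\{N,\lceil C_0M_{j'}\rceil\}$ with $$M_{j'}=\max\Big\{2^{\widetilde J(j')d}+\log\big((\log N)/\delta\big),\ N^{2\gamma}\sup_{0\le j\le J(j')}2^{-2jt-2j't'+2jr_1-2j'r_2+d\max\{j,j'\}}\Big\}$$ (supremum over an empty set is $0$). Let $\mathbf{U}^{(j')}_{\widetilde I_{j'}}$, $\mathbf{F}^{(j')}_{j'}$ be the submatrices of $\mathbf{U}_{\widetilde I_{j'}}$, $\mathbf{F}_{j'}$ formed by a common fixed set of $N_{j'}$ sample rows, and define $$(\widehat{\mathbf{A}}^\top)_{\widetilde I_{j'},j'}=\big((\mathbf{U}^{(j')}_{\widetilde I_{j'}})^\top\mathbf{U}^{(j')}_{\widetilde I_{j'}}\big)^{-1}(\mathbf{U}^{(j')}_{\widetilde I_{j'}})^\top\mathbf{F}^{(j')}_{j'}$$ (set to $0$ if the Gram matrix is singular), all other entries of $\widehat{\mathbf{A}}^\top$ being $0$. The estimator is $\widehat{\mathcal{A}}=\sum_{(\lambda,\lambda')\in\mathcal{E}_N}(\widehat{\mathbf{A}}^\top)_{\lambda,\lambda'}\varphi_{\lambda'}\otimes\varphi_\lambda$.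 Cost model. $\mathsf{Cost}(\varepsilon)$ is the number of arithmetic operations needed to construct the estimator from the finite collection of wavelet coefficient data it uses, when, for each $j'$, the regression is solved by dense direct least squares: forming the Gram matrix, multiplying with the response matrix and inverting the Gram matrix, where the product of an $a\times b$ and a $b\times c$ matrix costs $O(abc)$ operations and inverting a $p\times p$ matrix costs $O(p^3)$ operations. *)

(* Defs.v *)
From HB Require Import structures.
From mathcomp Require Import all_boot all_order all_algebra.
From mathcomp Require Import all_classical all_reals all_analysis.

Set Implicit Arguments.
Unset Strict Implicit.
Unset Printing Implicit Defensive.

Import Order.TTheory GRing.Theory Num.Theory.
Import numFieldNormedType.Exports.

Local Open Scope classical_set_scope.
Local Open Scope ring_scope.

(* Real distributions on the torus (R/Z)^d are identified with the families of
   their coefficients in the real orthonormal trigonometric basis of L^2: for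
   k in Z^d, the basis function is 1 if k = 0, and otherwise
   sqrt 2 * cos (2 pi k.x) or sqrt 2 * sin (2 pi k.x) according to which one
   of k and -k lies in a fixed half of Z^d \ {0}.  The Laplacian is diagonal
   in this basis, with eigenvalues - 4 pi^2 |k|^2. *)
Definition freq (d : nat) := 'rV[int]_d.

Definition dist (R : realType) (d : nat) := freq d -> R.

Definition bracket2 (R : realType) (d : nat) (k : freq d) : R :=
  1 + 4 * pi ^+ 2 * \sum_(i < d) (k ord0 i)%:~R ^+ 2.

(* (I - Laplacian)^a *)
Definition bessel (R : realType) (d : nat) (a : R) (h : dist R d) : dist R d :=
  fun k => bracket2 R k `^ a * h k.

(* The square of the H^a norm; +oo outside H^a. *)
Definition sobolev2 (R : realType) (d : nat) (a : R) (h : dist R d) : \bar R :=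
  \esum_(k in [set: freq d]) ((bessel (a / 2) h k) ^+ 2)%:E.

Definition in_sobolev (R : realType) (d : nat) (a : R) (h : dist R d) : Prop :=
  (sobolev2 a h < +oo)%E.

(* Sum of an absolutely summable real family (junk for other families). *)
Definition rsum (R : realType) (T : choiceType) (x : T -> R) : R :=
  fine (\esum_(k in [set: T]) (Num.max (x k) 0)%:E) -
  fine (\esum_(k in [set: T]) (Num.max (- x k) 0)%:E).

(* The L^2 inner product, extended to the duality of H^a and H^(-a). *)
Definition pairing (R : realType) (d : nat) (h g : dist R d) : R :=
  rsum (fun k => h k * g k).

(* S is the set of the Sobolev indices a for which the basis characterizes
   H^a. *)
Record wavelet_basis (R : realType) (d : nat) (S : set R) := WaveletBasis {
  nabla : nat -> finType;
  wav : {j : nat & nabla j} -> dist R d;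
  card_nabla : exists c C : R, [/\ 0 < c, 0 < C & forall j : nat,
    c * 2 ^+ (j * d) <= #|nabla j|%:R <= C * 2 ^+ (j * d)];
  wav_L2 : forall l, in_sobolev 0 (wav l);
  wav_orthonormal : forall l m, pairing (wav l) (wav m) = (l == m)%:R;
  wav_complete : forall h, in_sobolev 0 h ->
    (forall l, pairing h (wav l) = 0) -> forall k, h k = 0;
  wav_regular : forall a, S a -> forall l, in_sobolev (- a) (wav l);
  wav_sobolev : forall a, S a -> exists c C : R, [/\ 0 < c, 0 < C &
    forall h, in_sobolev a h ->
      let w2 := \esum_(l in [set: {j : nat & nabla j}])
        (2 `^ (2 * a * (tag l)%:R) * pairing h (wav l) ^+ 2)%:E in
      (c%:E * sobolev2 a h <= w2 <= C%:E * sobolev2 a h)%E] }.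

Section ObservationModel.
Context (R : realType) (d : nat).

Definition bounded_operator (s s' Rad : R) (A : dist R d -> dist R d) : Prop :=
  (forall (a : R) g h, in_sobolev s g -> in_sobolev s h ->
     A (fun k => a * g k + h k) = (fun k => a * A g k + A h k)) /\
  (forall h, in_sobolev s h ->
     (sobolev2 (- s') (A h) <= (Rad ^+ 2)%:E * sobolev2 s h)%E).

Context (disp : measure_display) (Omega : measurableType disp).
Context (P : probability Omega R).

(* Centered Gaussian field with covariance operator (I - Laplacian)^(-r),
   tested against trigonometric polynomials.  The zero polynomial is left
   out because normal_prob 0 0 is not a Dirac mass. *)
Definition gaussian_field (r : R) (u : Omega -> dist R d) : Prop :=
  (forall k, measurable_fun [set: Omega] (fun x => u x k)) /\
  (forall psi : dist R d, finite_set [set k | psi k != 0] ->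
     (exists k, psi k != 0) ->
     forall B : set R, measurable B ->
       P [set x | B (pairing (u x) psi)] =
       normal_prob 0 (Num.sqrt (pairing (bessel (- r) psi) psi)) B).

Definition field_sigma (u : Omega -> dist R d) : set_system Omega :=
  <<s [set E | exists k (B : set R), measurable B /\
                 E = [set x | B (u x k)]] >>.

Definition independent_fields (I : finType) (X : I -> Omega -> dist R d) :=
  forall E : I -> set Omega, (forall i, field_sigma (X i) (E i)) ->
    P (\bigcap_(i in [set: I]) E i) = (\prod_(i : I) P (E i))%E.

Definition observation_model (s s' r1 r2 Rad : R) (N : nat)
    (A : dist R d -> dist R d) (u w : 'I_N -> Omega -> dist R d) : Prop :=
  [/\ bounded_operator s s' Rad A,
      forall i, gaussian_field r1 (u i),
      forall i, gaussian_field r2 (w i) &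
      independent_fields (fun q : 'I_N + 'I_N =>
        match q with inl i => u i | inr i => w i end)].

(* A is only meaningful on H^s, to which u_i belongs almost surely when
   r1 - d/2 > s. *)
Definition observation (N : nat) (A : dist R d -> dist R d)
    (u w : 'I_N -> Omega -> dist R d) (i : 'I_N) (x : Omega) : dist R d :=
  fun k => A (u i x) k + w i x k.

End ObservationModel.

Definition pos_part (R : realType) (a : R) : R := Num.max a 0.

Definition log2 (R : realType) (x : R) : R := ln x / ln 2.

Record params (R : realType) := Params {
  pd : nat; ps : R; ps' : R; pr1 : R; pr2 : R; pt : R; pt' : R }.

Section Cutoffs.
Context (R : realType) (th : params R).
Let d := pd th.
Let s := ps th.
Let s' := ps' th.
Let r1 := pr1 th.
Let r2 := pr2 th.
Let t := pt th.
Let t' := pt' th.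

(* With the convention a / 0 = +oo for a > 0. *)
Definition gamma : R :=
  let g := Num.min (1 / 2) ((t - s) / (2 * (r1 - s) + d%:R)) in
  let q := pos_part (2 * (- r2 - s') + d%:R) in
  if q == 0 then g else Num.min g ((t' - s') / q).

Definition kappa_in : R :=
  2 + 2 * d%:R / (Num.min r1 t - s)
    + pos_part (2 * (r1 - t) + d%:R) / (t - s).

Definition kappa_out : R :=
  (d%:R + pos_part (2 * (- r2 - s') + d%:R)) / (t' - s').

Definition kappa : R := Num.max kappa_in kappa_out.

Context (N : nat).

Definition jmax : int := Num.ceil (gamma * log2 N%:R / (t' - s')).

Definition Jcut (j' : nat) : int :=
  Num.ceil ((gamma * log2 N%:R - j'%:R * (t' - s')) / (t - s)).

Definition Jtilde (j' : nat) : int :=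
  Num.ceil ((gamma * log2 N%:R - j'%:R * (t' - s')) / (Num.min r1 t - s)).

(* The number of scales 0, ..., J; the range is empty if J < 0. *)
Definition nscales (J : int) : nat := if J is Posz n then n.+1 else 0%N.

Definition Mval (delta : R) (j' : nat) : R :=
  Num.max
    (2 `^ ((Jtilde j')%:~R * d%:R) + ln (ln N%:R / delta))
    (N%:R `^ (2 * gamma) *
     \big[Num.max/0]_(j < nscales (Jcut j'))
        2 `^ (- 2 * j%:R * t - 2 * j'%:R * t' + 2 * j%:R * r1
              - 2 * j'%:R * r2 + d%:R * (maxn j j')%:R)).

Definition sample_size (C0 delta : R) (j' : nat) : nat :=
  minn N `|Num.ceil (C0 * Mval delta j')|%N.

End Cutoffs.

(* Numbers of arithmetic operations of dense linear algebra: O(abc) for an a x b by b x c product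
   and O(p^3) for the inversion of a p x p matrix. *)
Record cost_model := CostModel {
  mul_cost : nat -> nat -> nat -> nat;
  inv_cost : nat -> nat;
  mul_costO : exists K : nat, forall a b c : nat,
    (mul_cost a b c <= K * (a * b * c))%N;
  inv_costO : exists K : nat, forall p : nat, (inv_cost p <= K * p ^ 3)%N }.

(* A value together with the number of operations spent to compute it. *)
Definition costed (T : Type) : Type := T * nat.
Definition value (T : Type) (x : costed T) : T := x.1.
Definition cost (T : Type) (x : costed T) : nat := x.2.

Definition data (T : Type) (x : T) : costed T := (x, 0%N).

Definition cmul (R : realType) (cm : cost_model) (m n p : nat)
    (A : costed 'M[R]_(m, n)) (B : costed 'M[R]_(n, p)) :
    costed 'M[R]_(m, p) :=
  (value A *m value B, (cost A + cost B + mul_cost cm m n p)%N).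

Definition cinv (R : realType) (cm : cost_model) (n : nat)
    (A : costed 'M[R]_n) : costed 'M[R]_n :=
  (if value A \in unitmx then invmx (value A) else 0,
   (cost A + inv_cost cm n)%N).

Definition least_squares (R : realType) (cm : cost_model) (n p q : nat)
    (U : 'M[R]_(n, p)) (F : 'M[R]_(n, q)) : costed 'M[R]_(p, q) :=
  let gram := cmul cm (data U^T) (data U) in
  let rhs := cmul cm (data U^T) (data F) in
  cmul cm (cinv cm gram) rhs.

Lemma least_squares_value (R : realType) (cm : cost_model) (n p q : nat)
    (U : 'M[R]_(n, p)) (F : 'M[R]_(n, q)) :
  value (least_squares cm U F) =
  if U^T *m U \in unitmx then invmx (U^T *m U) *m U^T *m F else 0.
Proof.
by rewrite /value/=; case: ifP => _; rewrite ?mul0mx// mulmxA.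
Qed.

Section Estimator.
Context (R : realType) (th : params R) (S : set R).
Context (W : wavelet_basis (pd th) S) (cm : cost_model).
Context (N : nat) (u f : 'I_N -> dist R (pd th)) (rows : nat -> {set 'I_N}).

Definition Lambda := {j : nat & nabla W j}.

(* The wavelet indices whose scale belongs to {0, ..., Jtilde j'}. *)
Definition Lambda_in (j' : nat) : finType :=
  {j : 'I_(nscales (Jtilde th N j')) & nabla W j}.

Definition Lambda_of (j' : nat) (l : Lambda_in j') : Lambda :=
  Tagged (fun j => nabla W j) (tagged l).

Definition U_block (j' : nat) : 'M[R]_(#|rows j'|, #|Lambda_in j'|) :=
  \matrix_(i, l)
    pairing (u (enum_val i)) (wav (Lambda_of (enum_val l))).

Definition F_block (j' : nat) : 'M[R]_(#|rows j'|, #|nabla W j'|) :=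
  \matrix_(i, k)
    pairing (f (enum_val i))
      (wav (Tagged (fun j => nabla W j) (enum_val k))).

Definition block (j' : nat) : costed 'M[R]_(#|Lambda_in j'|, #|nabla W j'|) :=
  least_squares cm (U_block j') (F_block j').

(* The sum has at most one term, and none if the scale of l is larger than
   Jtilde (tag l'). *)
Definition Ahat_T (l l' : Lambda) : R :=
  if ((tag l')%:Z <= jmax th N)%R then
    \sum_(x : Lambda_in (tag l') | Lambda_of x == l)
      value (block (tag l')) (enum_rank x) (enum_rank (tagged l'))
  else 0.

Definition E_N : set (Lambda * Lambda) :=
  [set q | (tag q.1)%:R * (pt th - ps th) + (tag q.2)%:R * (pt' th - ps' th)
           <= gamma th * log2 N%:R].

Definition estimator : costed (dist R (pd th) -> dist R (pd th)) :=
  (fun h k => \sum_(q \in E_N) Ahat_T q.1 q.2 * pairing h (wav q.1)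
                                * wav q.2 k,
   (\sum_(j' < nscales (jmax th N)) cost (block j'))%N).

End Estimator.

(* Main.v *)
Require Import Defs.
From HB Require Import structures.
From mathcomp Require Import all_boot all_order all_algebra.
From mathcomp Require Import all_classical all_reals all_analysis.
From mathcomp Require Import zify ring lra.

Set Implicit Arguments.
Unset Strict Implicit.
Unset Printing Implicit Defensive.

Import Order.TTheory GRing.Theory Num.Theory.
Import numFieldNormedType.Exports.

Local Open Scope classical_set_scope.
Local Open Scope ring_scope.

(** The bound is deterministic: the cost depends on the data only through the
    sizes of the matrices in each block.

    Put X = gamma log2 N, so that eps^-1 = 2^X, and for an output scale j' let
    y = max (X - j'(t' - s')) 0 be what remains of the budget X for the input
    scales.  With b = min (r1, t) - s, a = t - s, and writing x_+ for the
    positive part, the regression of the scale j' has, up to constants,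
    - at most P = 2^(d y / b) regressors ([card_Lambda_in_le]),
    - at most Q = 2^(d j') responses,
    - at most L Z rows, where L = 1 + ln N + ln (1/delta) and
      Z = 2^((2 + (2(r1-t)+d)_+ / a) y + (2(-r2-s')+d)_+ j')
      ([sample_size_le]).
    The dominant term of the rows bound is the noise term of the sample size:
    after substituting N^(2 gamma) = 2^(2X), the part of its exponent which
    depends on t' cancels against X and leaves at most 2y ([noise_exp_le]).
    The dimension term is of order P, which is at most Z.

    The key comparison is this P <= Z ([width_le_rows_exp]), that is
    d / b <= 2 + (2(r1-t)+d)_+ / a.  If r1 <= t this is 2(r1 - s) >= d, which
    is the hypothesis that the input field belongs to H^s; if r1 > t, then
    b = a and 2(r1-t)+d >= d.  Thanks to it, all four terms p^2 n, p n q, p^3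
    and p^2 q of the cost of dense least squares are dominated by the single
    product P^2 Z Q ([least_squares_cost_envelope]).  The logarithm of that
    product is exactly kappa_in y + kappa_out (t' - s') j', and since
    y + j'(t' - s') <= X + (t' - s') on the scales that are used, it is at most
    kappa X up to an additive constant ([total_exp_le]).  Each block therefore
    costs O(L eps^-kappa), and there are O(1 + ln eps^-1) blocks. *)

(** * Scales, logarithms and dense least squares *)

(** The 2 covers both the rounding up and the scale 0; the maximum with 0
    covers the empty range of scales. *)
Lemma nscales_ceil_le (R : realType) (x : R) :
  (nscales (Num.ceil x))%:R <= Num.max x 0 + 2.
Proof.
have := ceilB1_lt x; case: (Num.ceil x) => n /= hx; last first.
  have : (0 : R) <= Num.max x 0 by rewrite le_max lexx orbT.
  lra.
have : x <= Num.max x 0 by rewrite le_max lexx.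
move: hx; rewrite intrD mulrNz -pmulrn -natr1; lra.
Qed.

Lemma sum_exp2_le (R : realType) (d n : nat) : (1 <= d)%N ->
  \sum_(j < n) (2 : R) ^+ (j * d) <= 2 ^+ (n * d).
Proof.
move=> hd; elim: n => [|n IHn]; first by rewrite big_ord0 mul0n expr0.
rewrite big_ord_recr/= mulSn exprD.
have h2 : (2 : R) <= 2 ^+ d by rewrite -[leLHS]expr1 ler_weXn2l// ler1n.
have : (0 : R) <= 2 ^+ (n * d) by rewrite exprn_ge0.
nra.
Qed.

Lemma powR_log2 (R : realType) (x : R) : 0 < x -> 2 `^ log2 x = x.
Proof.
move=> x0; have l2 : ln (2 : R) != 0 by rewrite gt_eqF// ln_gt0// ltr1n.
by rewrite /powR pnatr_eq0/= divfK// lnK.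
Qed.

Lemma least_squares_cost_le (cm : cost_model) : exists K : nat,
  forall (R : realType) (n p q : nat) (U : 'M[R]_(n, p)) (F : 'M[R]_(n, q)),
  (cost (least_squares cm U F)
     <= K * (p ^ 2 * n + p * n * q + p ^ 3 + p ^ 2 * q))%N.
Proof.
have [K1 h1] := mul_costO cm; have [K2 h2] := inv_costO cm.
exists (K1 + K2)%N => R n p q U F.
rewrite /least_squares /cost /= -/(cost _).
have := h1 p n p; have := h1 p n q; have := h1 p p q; have := h2 p.
nia.
Qed.

(** The product P^2 Z Q dominates each of p^2 n, p n q, p^3 and p^2 q because
    P <= Z and all three factors are at least 1. *)
Lemma least_squares_cost_envelope (R : realType) (cm : cost_model) :
  exists2 K : R, 0 < K & forall c P Z Q : R,
    0 <= c -> 1 <= P -> P <= Z -> 1 <= Q ->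
  forall (n p q : nat) (U : 'M[R]_(n, p)) (F : 'M[R]_(n, q)),
    p%:R <= c * P -> n%:R <= c * Z -> q%:R <= c * Q ->
  (cost (least_squares cm U F))%:R <= K * (c ^+ 3 * (P ^+ 2 * Z * Q)).
Proof.
have [K hK] := least_squares_cost_le cm.
exists (4 * K.+1%:R) => [|c P Z Q c0 P1 PZ Q1 n p q U F hp hn hq].
  by rewrite mulr_gt0// ltr0n.
have P0 : 0 <= P by lra.
have Z0 : 0 <= Z by lra.
have Q0 : 0 <= Q by lra.
set B := c ^+ 3 * (P ^+ 2 * Z * Q).
(* The four costs are products of three dimensions each. *)
have prod3 (a b e : nat) (x y z : R) : 0 <= x -> 0 <= y -> 0 <= z ->
    x * y * z <= P ^+ 2 * Z * Q ->
    a%:R <= c * x -> b%:R <= c * y -> e%:R <= c * z ->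
    (a%:R : R) * b%:R * e%:R <= B.
  move=> x0 y0 z0 xyz ha hb he.
  apply: (@le_trans _ _ ((c * x) * (c * y) * (c * z))).
    by rewrite !ler_pM ?mulr_ge0.
  rewrite (_ : _ * _ * _ = c ^+ 3 * (x * y * z)); last by ring.
  by rewrite ler_wpM2l// exprn_ge0.
have PP0 : 0 <= P ^+ 2 by rewrite exprn_ge0.
have t1 : (p%:R : R) * p%:R * n%:R <= B.
  apply: (prod3 _ _ _ P P Z) => //.
  by rewrite -expr2 ler_peMr// mulr_ge0.
have t2 : (p%:R : R) * n%:R * q%:R <= B.
  apply: (prod3 _ _ _ P Z Q) => //.
  by rewrite ler_wpM2r// ler_wpM2r// expr2 ler_peMr.
have t3 : (p%:R : R) * p%:R * p%:R <= B.
  apply: (prod3 _ _ _ P P P) => //.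
  rewrite -expr2 (le_trans (ler_wpM2l PP0 PZ))// ler_peMr// mulr_ge0//.
have t4 : (p%:R : R) * p%:R * q%:R <= B.
  apply: (prod3 _ _ _ P P Q) => //.
  by rewrite -expr2 ler_wpM2r// ler_peMr//; lra.
have B0 : 0 <= B by rewrite !mulr_ge0// exprn_ge0.
apply: (@le_trans _ _ ((K * (p ^ 2 * n + p * n * q + p ^ 3 + p ^ 2 * q))%:R)).
  by rewrite ler_nat; exact: hK.
rewrite natrM (_ : 4 * K.+1%:R * B = K.+1%:R * (B + B + B + B)); last by ring.
apply: ler_pM => //; first by rewrite ler_nat.
rewrite !natrD !lerD// ?expnS ?expn0 ?muln1 !natrM// mulrA //.
Qed.

(** * Exponents of the block dimensions *)

Section Exponents.
Context (R : realType) (th : params R).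
Local Notation d := (pd th).
Local Notation s := (ps th).
Local Notation s' := (ps' th).
Local Notation r1 := (pr1 th).
Local Notation r2 := (pr2 th).
Local Notation t := (pt th).
Local Notation t' := (pt' th).

Hypotheses (hd : (1 <= d)%N) (hr1 : s < r1 - d%:R / 2).
Hypotheses (ht : s < t) (ht' : s' < t').

(** Growth exponent, per input scale, of the noise term of the sample size;
    it also appears in [kappa_in]. *)
Definition excess_in : R := pos_part (2 * (r1 - t) + d%:R).

(** Growth exponent of the same term per output scale, once the decay in
    t' - s' has been charged to the budget. *)
Definition excess_out : R := pos_part (2 * (- r2 - s') + d%:R).

Definition budget (N : nat) : R := gamma th * log2 N%:R.

(** The part of the budget that the output scale leaves to the input scales.
    It is truncated at 0 because the last output scale is rounded up and may
    overrun the budget. *)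
Definition slack (N j' : nat) : R :=
  Num.max (budget N - j'%:R * (t' - s')) 0.

(** Binary logarithms of the bounds on the numbers of regressors and of rows,
    up to additive constants. *)
Definition width_exp (N j' : nat) : R :=
  d%:R / (Num.min r1 t - s) * slack N j'.

Definition rows_exp (N j' : nat) : R :=
  (2 + excess_in / (t - s)) * slack N j' + j'%:R * excess_out.

Lemma pos_part_ge0 (a : R) : 0 <= pos_part a.
Proof. by rewrite /pos_part le_max lexx orbT. Qed.

Lemma pos_part_ge (a : R) : a <= pos_part a.
Proof. by rewrite /pos_part le_max lexx. Qed.

Lemma slack_ge0 N j' : 0 <= slack N j'. Proof. exact: pos_part_ge0. Qed.

Lemma d_gt0 : 0 < d%:R :> R. Proof. by rewrite ltr0n. Qed.

Lemma min_smoothness_gt0 : 0 < Num.min r1 t - s.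
Proof.
have d0 := d_gt0; have hr := hr1; have sr1 : s < r1 by lra.
by rewrite subr_gt0 lt_min ht andbT.
Qed.

Lemma gamma_gt0 : 0 < gamma th.
Proof.
have d0 := d_gt0; have hr := hr1; have a0 : 0 < t - s by rewrite subr_gt0.
have g0 : 0 < Num.min (1 / 2) ((t - s) / (2 * (r1 - s) + d%:R)).
  by rewrite lt_min divr_gt0// divr_gt0; lra.
rewrite /gamma; case: ifPn => // q0.
rewrite lt_min g0/= divr_gt0 ?subr_gt0//.
by rewrite lt_neqAle eq_sym q0 pos_part_ge0.
Qed.

(** Adding d inside the maximum that defines the positive part. *)
Lemma kappa_outE : kappa_out th =
  Num.max (d%:R / (t' - s')) ((2 * (- r2 - s') + 2 * d%:R) / (t' - s')).
Proof.
have a0 : 0 < (t' - s')^-1 by rewrite invr_gt0 subr_gt0.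
rewrite /kappa_out -maxr_pMl ?ltW//; congr (_ * _).
rewrite /pos_part addr_maxr addr0 maxC; congr (Num.max _ _); lra.
Qed.

(** If r1 <= t, the claim d / (r1 - s) <= 2 is the assumption r1 - d/2 > s.
    Otherwise min (r1, t) = t and [excess_in] is at least d, so the second
    summand of the rows exponent suffices. *)
Lemma width_le_rows_exp N j' : width_exp N j' <= rows_exp N j'.
Proof.
rewrite /width_exp /rows_exp.
apply: (@le_trans _ _ ((2 + excess_in / (t - s)) * slack N j')); last first.
  by rewrite lerDl mulr_ge0// pos_part_ge0.
apply: ler_wpM2r; first exact: slack_ge0.
have d0 := d_gt0; have hr := hr1; have a0 : 0 < t - s by rewrite subr_gt0.
have h0 := pos_part_ge0 (2 * (r1 - t) + d%:R).
have h1 := pos_part_ge (2 * (r1 - t) + d%:R).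
have [r1t|r1t] := leP r1 t.
  have : 0 <= excess_in / (t - s) by rewrite divr_ge0// ltW.
  suff : d%:R / (r1 - s) <= 2 by lra.
  by rewrite ler_pdivrMr; lra.
have : d%:R / (t - s) <= excess_in / (t - s).
  by rewrite ler_pM2r ?invr_gt0// /excess_in; lra.
lra.
Qed.

Lemma width_exp_ge0 N j' : 0 <= width_exp N j'.
Proof. by rewrite mulr_ge0 ?slack_ge0// divr_ge0// ltW ?min_smoothness_gt0. Qed.

Lemma rows_exp_ge0 N j' : 0 <= rows_exp N j'.
Proof. exact: le_trans (width_exp_ge0 N j') (width_le_rows_exp N j'). Qed.

Lemma nscales_budget_le N j' (a : R) : 0 < a ->
  (nscales (Num.ceil ((budget N - j'%:R * (t' - s')) / a)))%:R
    <= slack N j' / a + 2.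
Proof.
move=> a0; apply: (le_trans (nscales_ceil_le _)).
by rewrite /slack maxr_pMl ?mul0r// invr_ge0 ltW.
Qed.

(** The number of wavelets up to a scale is comparable to the number on that
    scale, since the sum over the scales is geometric. *)
Lemma card_Lambda_in_le (S : set R) (W : wavelet_basis d S) :
  exists2 c : R, 0 < c & forall N j',
    #|Lambda_in W N j'|%:R <= c * 2 `^ width_exp N j'.
Proof.
have [c0 [C [_ C0 hC]]] := card_nabla W.
exists (C * 2 `^ (2 * d%:R)) => [|N j'].
  by rewrite mulr_gt0// powR_gt0.
rewrite /Lambda_in card_tagged sumnE big_map big_enum/= natr_sum.
set n := nscales _.
apply: (@le_trans _ _ (\sum_(j < n) C * 2 ^+ (j * d))).
  by apply: ler_sum => j _; have /andP[] := hC j.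
rewrite -mulr_sumr -mulrA ler_pM2l//.
apply: (le_trans (sum_exp2_le _ _ hd)).
rewrite -powR_mulrn// -powRD ?pnatr_eq0 ?implybT//.
apply: ler_powR; first by rewrite ler1n.
have d0 := d_gt0; have := nscales_budget_le N j' min_smoothness_gt0.
rewrite -/(Jtilde th N j') -/n => hn.
have : n%:R * d%:R <= (slack N j' / (Num.min r1 t - s) + 2) * d%:R.
  by rewrite ler_pM2r.
rewrite /width_exp natrM; lra.
Qed.

(** With q = 2(-r2-s')+d, one has -2j'(t'+r2) = j'(q - d) - 2j'(t'-s'), and the
    last summand turns 2X into at most twice the slack.  What remains is
    j(2(r1-t)+d) + j'(q-d) or 2j(r1-t) + j'q according to the larger of j and
    j'; both are at most j [excess_in] + j' [excess_out], and j is at most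
    slack / (t - s) + 1. *)
Lemma noise_exp_le N j' (j : 'I_(nscales (Jcut th N j'))) :
  2 * budget N +
  (- 2 * j%:R * t - 2 * j'%:R * t' + 2 * j%:R * r1
     - 2 * j'%:R * r2 + d%:R * (maxn j j')%:R) <= rows_exp N j' + excess_in.
Proof.
have a0 : 0 < t - s by rewrite subr_gt0.
have hj : j%:R + 1 <= slack N j' / (t - s) + 2.
  by rewrite natr1 (le_trans _ (nscales_budget_le N j' a0))// ler_nat.
have hy : budget N - j'%:R * (t' - s') <= slack N j' := pos_part_ge _.
have y0 := slack_ge0 N j'.
have d0 := d_gt0.
have i0 := pos_part_ge0 (2 * (r1 - t) + d%:R).
have i1 := pos_part_ge (2 * (r1 - t) + d%:R).
have o0 := pos_part_ge0 (2 * (- r2 - s') + d%:R).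
have o1 := pos_part_ge (2 * (- r2 - s') + d%:R).
rewrite -/excess_in -/excess_out in i0 i1 o0 o1.
have jin : j%:R * (2 * (r1 - t) + d%:R) <= j%:R * excess_in.
  by rewrite ler_wpM2l.
have jout : j'%:R * (2 * (- r2 - s') + d%:R) <= j'%:R * excess_out.
  by rewrite ler_wpM2l.
have jy : j%:R * excess_in <= (slack N j' / (t - s) + 1) * excess_in.
  by rewrite ler_wpM2r//; lra.
have jd : 0 <= j%:R * d%:R :> R by rewrite mulr_ge0.
have j'd : 0 <= j'%:R * d%:R :> R by rewrite mulr_ge0.
rewrite /rows_exp (_ : (2 + _ / _) * _ =
  2 * slack N j' + slack N j' / (t - s) * excess_in); last by ring.
move: jy; set y := slack N j' / (t - s) => jy.
rewrite /maxn; case: ifP => _; lra.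
Qed.

Lemma log_factor_ge1 N (delta : R) : (3 <= N)%N -> 0 < delta < 1 ->
  1 <= 1 + ln N%:R + ln delta^-1.
Proof.
move=> N3 /andP[de0 de1]; rewrite -addrA lerDl addr_ge0// ln_ge0//.
  by rewrite ler1n (leq_trans _ N3).
by rewrite invf_ge1// ltW.
Qed.

(** The constant has one summand for each contribution to the maximum: the
    dimension term, whose scale is rounded up, the confidence term, in which
    ln (ln N) is replaced by ln N at the price of one more logarithm, and the
    noise term. *)
Lemma Mval_le : exists2 c : R, 0 < c & forall N (delta : R) j',
    (3 <= N)%N -> 0 < delta < 1 ->
  Mval th N delta j' <= c * ((1 + ln N%:R + ln delta^-1) * 2 `^ rows_exp N j').
Proof.
exists (2 `^ d%:R + 1 + 2 `^ excess_in) => [|N delta j' N3 /andP[de0 de1]].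
  by rewrite !addr_gt0// powR_gt0.
have N0 : 0 < N%:R :> R by rewrite ltr0n (leq_trans _ N3).
have lN0 : 0 < ln N%:R :> R by rewrite ln_gt0// ltr1n (leq_trans _ N3).
have ld0 : 0 <= ln delta^-1 by rewrite ln_ge0// invf_ge1// ltW.
have d0 := d_gt0.
have rows0 := rows_exp_ge0 N j'.
set l := 1 + _ + _; set Z := 2 `^ rows_exp N j'.
have l1 : 1 <= l by rewrite /l; lra.
have Z1 : 1 <= Z by rewrite -[leLHS](powRr0 2) ler_powR// ler1n.
have D0 : 0 < 2 `^ d%:R :> R by rewrite powR_gt0.
have I0 : 0 < 2 `^ excess_in :> R by rewrite powR_gt0.
have lZ : l <= l * Z by rewrite ler_peMr//; lra.
have ZlZ : Z <= l * Z by rewrite ler_peMl//; lra.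
rewrite /Mval ge_max; apply/andP; split.
  apply: (@le_trans _ _ (2 `^ d%:R * (l * Z) + l * Z)); last first.
    have : 0 <= 2 `^ excess_in * (l * Z).
      by rewrite !mulr_ge0// ltW//; lra.
    lra.
  apply: lerD.
    apply: (@le_trans _ _ (2 `^ d%:R * Z)); last by rewrite ler_pM2l.
    rewrite /Z -powRD ?pnatr_eq0 ?implybT// ler_powR ?ler1n//.
    have := width_le_rows_exp N j'.
    have J : (Jtilde th N j')%:~R
        <= slack N j' / (Num.min r1 t - s) + 1.
      apply: ltW; have := ceilB1_lt ((budget N - j'%:R * (t' - s')) /
        (Num.min r1 t - s)).
      rewrite -/(Jtilde th N j') intrB ltrBlDr => /lt_le_trans; apply.
      rewrite lerD2r ler_wpM2r ?pos_part_ge// invr_ge0 ltW//.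
      exact: min_smoothness_gt0.
    have : (Jtilde th N j')%:~R * d%:R <=
        (slack N j' / (Num.min r1 t - s) + 1) * d%:R by rewrite ler_pM2r.
    rewrite /width_exp; lra.
  apply: le_trans lZ.
  rewrite ln_div ?posrE// lnV ?posrE// in ld0 *.
  have := ln_sublinear lN0; rewrite /l lnV ?posrE//; lra.
apply: (@le_trans _ _ (2 `^ excess_in * Z)); last first.
  have : 0 <= (2 `^ d%:R + 1) * (l * Z).
    by rewrite !mulr_ge0//; lra.
  have : 2 `^ excess_in * Z <= 2 `^ excess_in * (l * Z) by rewrite ler_pM2l.
  lra.
have -> : N%:R `^ (2 * gamma th) = 2 `^ (2 * budget N).
  by rewrite -{1}(powR_log2 N0) -powRrM /budget; congr powR; ring.
rewrite -ler_pdivlMl ?powR_gt0//.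
apply: bigmax_le => [|j _]; first by rewrite !mulr_ge0// ?invr_ge0 powR_ge0.
rewrite ler_pdivlMl ?powR_gt0// -!powRD ?pnatr_eq0 ?implybT//.
by rewrite ler_powR ?ler1n// addrC [leRHS]addrC addrC; exact: noise_exp_le.
Qed.

Lemma sample_size_le (C0 : R) : 0 < C0 ->
  exists2 c : R, 0 < c & forall N (delta : R) j',
    (3 <= N)%N -> 0 < delta < 1 ->
  (sample_size th N C0 delta j')%:R
    <= c * ((1 + ln N%:R + ln delta^-1) * 2 `^ rows_exp N j').
Proof.
move=> C00; have [c c0 hc] := Mval_le.
exists (C0 * c + 1) => [|N delta j' N3 hde].
  by rewrite addr_gt0// mulr_gt0.
have M0 : 0 <= Mval th N delta j'.
  rewrite /Mval le_max; apply/orP; right.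
  by rewrite mulr_ge0 ?powR_ge0// bigmax_ge_id.
apply: (@le_trans _ _ (`|Num.ceil (C0 * Mval th N delta j')|%N%:R)).
  by rewrite ler_nat geq_minr.
have c00 : 0 <= Num.ceil (C0 * Mval th N delta j').
  by rewrite ceil_ge0 (lt_le_trans (ltrN10 _))// mulr_ge0// ltW.
rewrite natr_absz ger0_norm//.
have := ceilB1_lt (C0 * Mval th N delta j').
rewrite intrB.
have /(ler_wpM2l (ltW C00)) := hc N delta j' N3 hde.
suff : 1 <= (1 + ln N%:R + ln delta^-1) * 2 `^ rows_exp N j' by lra.
rewrite mulr_ege1 ?log_factor_ge1//.
by rewrite -[leLHS](powRr0 2) ler_powR ?ler1n// rows_exp_ge0.
Qed.

(** The left side equals kappa_in y + kappa_out (j'(t' - s')), where y is the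
    slack.  Here y + j'(t' - s') is the budget as long as the latter is not
    exceeded, and rounding up the last output scale exceeds it by at most
    t' - s'. *)
Lemma total_exp_le N j' : 0 <= budget N -> (j' < nscales (jmax th N))%N ->
  2 * width_exp N j' + rows_exp N j' + j'%:R * d%:R
    <= kappa th * (budget N + (t' - s')).
Proof.
move=> X0 hj; have a'0 : 0 < t' - s' by rewrite subr_gt0.
have a0 : 0 < t - s by rewrite subr_gt0.
have b0 := min_smoothness_gt0.
have in0 : 0 <= kappa_in th.
  by rewrite /kappa_in !addr_ge0// ?divr_ge0// ?pos_part_ge0// ?ltW// mulr_ge0.
have k0 : 0 <= kappa th by rewrite /kappa le_max in0.
have j'X : j'%:R * (t' - s') <= budget N + (t' - s').
  have : (j'%:R + 1 : R) <= Num.max (budget N / (t' - s')) 0 + 2.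
    rewrite natr1; apply: le_trans (nscales_ceil_le _).
    by rewrite ler_nat.
  rewrite max_l => [h|]; last by rewrite divr_ge0// ltW.
  have : j'%:R <= budget N / (t' - s') + 1 by lra.
  by rewrite -(ler_pM2r a'0) mulrDl divfK ?mul1r// gt_eqF.
have yX : slack N j' + j'%:R * (t' - s') <= budget N + (t' - s').
  rewrite /slack; case: (leP (budget N - j'%:R * (t' - s')) 0) => _; lra.
apply: le_trans (ler_wpM2l k0 yX).
have -> : 2 * width_exp N j' + rows_exp N j' + j'%:R * d%:R =
    kappa_in th * slack N j' + kappa_out th * (j'%:R * (t' - s')).
  rewrite /width_exp /rows_exp /kappa_in /kappa_out -/excess_in -/excess_out.
  by field; rewrite !gt_eqF.
rewrite [leRHS]mulrDr lerD// ler_wpM2r//.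
- exact: slack_ge0.
- by rewrite /kappa le_max lexx.
- by rewrite mulr_ge0// ltW.
- by rewrite /kappa le_max lexx orbT.
Qed.

(** * Cost of the blocks and of the estimator *)

Lemma block_cost_le (S : set R) (W : wavelet_basis d S) (cm : cost_model)
    (C0 : R) : 0 < C0 ->
  exists2 c : R, 0 < c & forall N (delta : R) j' (u f : 'I_N -> dist R d)
      (rows : nat -> {set 'I_N}),
    (3 <= N)%N -> 0 < delta < 1 ->
    #|rows j'| = sample_size th N C0 delta j' ->
  (cost (block W cm u f rows j'))%:R <=
    c * ((1 + ln N%:R + ln delta^-1) *
      2 `^ (2 * width_exp N j' + rows_exp N j' + j'%:R * d%:R)).
Proof.
move=> C00.
have [Kc Kc0 hcost] := least_squares_cost_envelope R cm.
have [c1 c10 hp] := card_Lambda_in_le W.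
have [c2 c20 hn] := sample_size_le C00.
have [c4 [c3 [_ c30 hq]]] := card_nabla W.
set c := c1 + c2 + c3; have c0 : 0 < c by rewrite !addr_gt0.
exists (Kc * c ^+ 3) => [|N delta j' u f rows N3 hde hrows].
  by rewrite mulr_gt0// exprn_gt0.
set L := 1 + ln N%:R + ln delta^-1.
have L1 : 1 <= L by exact: log_factor_ge1.
set p := width_exp N j'; set n := rows_exp N j'.
have one_le (y : R) : 0 <= y -> 1 <= 2 `^ y.
  by move=> y0; rewrite -[leLHS](powRr0 2) ler_powR// ler1n.
rewrite (_ : L * _ = (2 `^ p) ^+ 2 * (L * 2 `^ n) * 2 `^ (j'%:R * d%:R));
    last first.
  rewrite !powRD ?pnatr_eq0 ?implybT// [2 * p]mulrC (powRrM _ p 2).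
  by rewrite (powR_mulrn 2) ?powR_ge0//; ring.
rewrite -mulrA; apply: hcost.
- exact: ltW.
- exact/one_le/width_exp_ge0.
- rewrite (@le_trans _ _ (2 `^ n))//.
    by rewrite ler_powR ?ler1n ?width_le_rows_exp.
  by rewrite ler_peMl// powR_ge0.
- by rewrite one_le// mulr_ge0.
- apply: (le_trans (hp N j')).
  by rewrite ler_wpM2r ?powR_ge0// /c -addrA lerDl ltW// addr_gt0.
- rewrite hrows; apply: (le_trans (hn N delta j' N3 hde)).
  rewrite ler_wpM2r ?mulr_ge0 ?powR_ge0//; first exact: le_trans L1.
  by rewrite /c addrAC lerDr ltW// addr_gt0.
- have /andP[_] := hq j'; rewrite -natrM powR_mulrn// => /le_trans; apply.
  by rewrite ler_wpM2r ?exprn_ge0// /c lerDr ltW// addr_gt0.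
Qed.

(** Translates logarithms of N into logarithms of the accuracy eps = N^(-gamma),
    for which l = ln eps^-1. *)
Lemma log_factors_le (N : nat) (l D : R) : 0 <= l -> 0 <= D ->
  l = gamma th * ln N%:R ->
  1 + ln N%:R + D <= (1 + (gamma th)^-1) * ((1 + l) * (1 + D)).
Proof.
move=> l0 D0 lE; have g0 := gamma_gt0.
have -> : ln N%:R = (gamma th)^-1 * l by rewrite lE mulKf// gt_eqF.
have : 0 <= (gamma th)^-1 by rewrite invr_ge0 ltW.
move: (gamma th)^-1 => gi gi0.
have : 0 <= l * D by rewrite mulr_ge0.
have : 0 <= gi * D by rewrite mulr_ge0.
have : 0 <= gi * (l * D) by rewrite !mulr_ge0.
lra.
Qed.

Lemma nscales_jmax_le (N : nat) (l : R) : 0 <= l -> budget N = l / ln 2 ->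
  (nscales (jmax th N))%:R <= (2 + (ln 2 * (t' - s'))^-1) * (1 + l).
Proof.
move=> l0 XE; have a'0 : 0 < t' - s' by rewrite subr_gt0.
have l20 : 0 < ln 2 :> R by rewrite ln_gt0// ltr1n.
apply: (le_trans (nscales_ceil_le _)).
rewrite -/(budget N) XE max_l; last by rewrite !divr_ge0// ltW.
rewrite -mulrA -invfM.
have : 0 <= (ln 2 * (t' - s'))^-1 by rewrite invr_ge0 mulr_ge0// ltW.
lra.
Qed.

(** One logarithm of eps^-1 comes from the number of blocks, the other and the
    logarithm of delta^-1 from the confidence term in the numbers of rows. *)
Lemma estimator_cost_le (S : set R) (W : wavelet_basis d S) (cm : cost_model)
    (C0 : R) : 0 < C0 ->
  exists2 C : R, 0 < C & forall (eps : R) N (delta : R)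
      (u f : 'I_N -> dist R d) (rows : nat -> {set 'I_N}),
    0 < eps < 1 -> (3 <= N)%N -> eps = N%:R `^ (- gamma th) ->
    0 < delta < 1 ->
    (forall j', #|rows j'| = sample_size th N C0 delta j') ->
  (cost (estimator W cm u f rows))%:R <=
    C * (1 + ln eps^-1) ^+ 2 * (1 + ln delta^-1) * eps `^ (- kappa th).
Proof.
move=> C00; have [c c0 hblock] := block_cost_le W cm C00.
have g0 := gamma_gt0.
have a'0 : 0 < t' - s' by rewrite subr_gt0.
have l20 : 0 < ln 2 :> R by rewrite ln_gt0// ltr1n.
exists (c * (1 + (gamma th)^-1) * (2 + (ln 2 * (t' - s'))^-1)
          * 2 `^ (kappa th * (t' - s'))).
  by rewrite !mulr_gt0// ?powR_gt0// addr_gt0// invr_gt0// mulr_gt0.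
move=> eps N delta u f rows /andP[eps0 eps1] N3 epsE hde hrows.
have N0 : 0 < N%:R :> R by rewrite ltr0n (leq_trans _ N3).
have ld0 : 0 <= ln delta^-1.
  by case/andP: hde => de0 de1; rewrite ln_ge0// invf_ge1// ltW.
have le0 : 0 <= ln eps^-1 by rewrite ln_ge0// invf_ge1// ltW.
have leE : ln eps^-1 = gamma th * ln N%:R.
  by rewrite lnV ?posrE// epsE ln_powR mulNr opprK.
have XE : budget N = ln eps^-1 / ln 2 by rewrite leE -mulrA.
have X0 : 0 <= budget N by rewrite XE divr_ge0// ltW.
have epsX : eps `^ (- kappa th) = 2 `^ (kappa th * budget N).
  rewrite epsE -powRrM -{1}(powR_log2 N0) -powRrM; congr powR.
  by rewrite /budget; ring.
have logs := log_factors_le le0 ld0 leE.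
have scales := nscales_jmax_le le0 XE.
rewrite /estimator {1}/cost/= natr_sum epsX.
move: logs scales; set l := ln eps^-1; set D := ln delta^-1 => logs scales.
set B := c * ((1 + (gamma th)^-1) * ((1 + l) * (1 + D))
               * 2 `^ (kappa th * (budget N + (t' - s')))).
have gi0 : 0 <= (gamma th)^-1 by rewrite invr_ge0 ltW.
have B0 : 0 <= B.
  by rewrite !mulr_ge0 ?powR_ge0 ?addr_ge0//; exact: ltW.
apply: (@le_trans _ _ (\sum_(j < nscales (jmax th N)) B)).
  apply: ler_sum => j _.
  apply: (le_trans (hblock N delta j u f rows N3 hde (hrows j))).
  rewrite /B ler_pM2l//; apply: ler_pM => //; rewrite ?powR_ge0//.
    by rewrite (le_trans ler01)// log_factor_ge1.
  by rewrite ler_powR ?ler1n// total_exp_le.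
rewrite sumr_const card_ord -[B *+ _]mulr_natl.
apply: (le_trans (ler_wpM2r B0 scales)).
rewrite /B [kappa th * (_ + _)]mulrDr powRD ?pnatr_eq0 ?implybT//.
by rewrite le_eqVlt; apply/orP; left; apply/eqP; ring.
Qed.

End Exponents.

Theorem proposition5p1 (R : realType) (d : nat) (s s' r1 r2 t t' C0 : R)
    (hd : (1 <= d)%N) (hr1 : s < r1 - d%:R / 2) (ht : s < t) (ht' : s' < t')
    (hC0 : 0 < C0)
    (S : set R) (hS : [set s; - s'; t; - t'] `<=` S)
    (hw : exists2 a : R, S a & a < r2 - d%:R / 2)
    (W : wavelet_basis d S) (cm : cost_model) :
  let th := Params d s s' r1 r2 t t' in
  kappa_out th = Num.max (d%:R / (t' - s'))
                         ((2 * (- r2 - s') + 2 * d%:R) / (t' - s')) /\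
  exists (C : R) (K : nat), 0 < C /\
    forall (eps : R) (N : nat) (delta : R),
      0 < eps < 1 -> (3 <= N)%N -> eps = N%:R `^ (- gamma th) ->
      0 < delta < 1 ->
    forall (rows : nat -> {set 'I_N}),
      (forall j' : nat, #|rows j'| = sample_size th N C0 delta j') ->
    forall (disp : measure_display) (Omega : measurableType disp)
      (P : probability Omega R) (Rad : R) (A : dist R d -> dist R d)
      (u w : 'I_N -> Omega -> dist R d),
      0 < Rad -> observation_model P s s' r1 r2 Rad A u w ->
    forall x : Omega,
      (cost (@estimator R th S W cm N (u ^~ x)
               (fun i => observation A u w i x) rows))%:R
      <= C * (1 + ln eps^-1) ^+ K * (1 + ln delta^-1) ^+ K
           * eps `^ (- kappa th).
Proof.
move=> th; split; first exact: (@kappa_outE R th).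
have [C C_gt0 hC] := @estimator_cost_le R th hd hr1 ht ht' S W cm C0 hC0.
exists C, 2%N; split=> // eps N delta heps N3 epsE hde rows hrows.
move=> disp Omega P Rad A u w _ _ x.
apply: le_trans (hC eps N delta _ _ rows heps N3 epsE hde hrows) _.
have [/andP[eps0 eps1] /andP[de0 de1]] := (heps, hde).
have ld0 : 0 <= ln delta^-1 by rewrite ln_ge0// invf_ge1// ltW.
rewrite ler_wpM2r ?powR_ge0// ler_wpM2l//.
  by rewrite mulr_ge0 ?exprn_ge0// ?addr_ge0 ?ln_ge0 ?invf_ge1// ltW.
by rewrite -[leLHS]expr1 ler_weXn2l// lerDl.
Qed.
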